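(* Let $p,q,r\ge0$ and let $$\lambda=(3k_1,\dots,3k_p,\;3m_1+1,\dots,3m_q+1,\;3n_1+2,\dots,3n_r+2)$$ be a weakly positive partition, where all $k_i,m_i,n_i$ are non-negative integers. Let $A_\lambda=Q_\lambda(\delta_{k,3}/3)$. Then $$A_\lambda=\frac{\delta_{q,r}(-1)^{r(r-1)/2}\,2^r\,(2/3)^{|\lambda|/3}}{\prod_{i=1}^pk_i!\prod_{i=1}^qm_i!\prod_{i=1}^rn_i!}\;\prod_{1\le i<j\le p}\frac{k_i-k_j}{k_i+k_j}\;\frac{\prod_{1\le i<j\le r}(m_i-m_j)(n_i-n_j)}{\prod_{i,j=1}^r(m_i+n_j+1)},$$ where $\delta_{q,r}=1$ if $q=r$ and $\delta_{q,r}=0$ if $q\ne r$ (so the right-hand side is understood to be $0$ when $q\neq r$). In particular, $A_\lambda=0$ if $q\ne r$.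
   Context: Partitions: a partition of length $l(\lambda)=l$ is a finite sequence $\lambda=(\lambda_1,\dots,\lambda_l)$ of non-negative integers (in any order); $|\lambda|=\sum_i\lambda_i$. It is positive if all parts are positive, and weakly positive if at most one part is $0$. Schur Q-polynomials in $\mathbf t=(t_1,t_3,t_5,\dots)$ (normalized as in Macdonald's book): define $q_k(\mathbf t)$ by $\sum_{k\ge0}q_k(\mathbf t)z^k=\exp\big(2\sum_{k\ge0}t_{2k+1}z^{2k+1}\big)$. For non-negative integers $(r,s)\ne(0,0)$ put $M_{(r,s)}=q_rq_s+2\sum_{i=1}^s(-1)^iq_{r+i}q_{s-i}$, and $M_{(0,0)}=0$. For a weakly positive partition $\lambda=(\lambda_1,\dots,\lambda_{2m})$ of even length, $Q_\lambda(\mathbf t)=\mathrm{Pf}(M_{(\lambda_i,\lambda_j)})_{1\le i,j\le 2m}$; for positive $\lambda$ of odd length, $Q_\lambda=Q_{(\lambda,0)}$, where $(\lambda,0)$ is $\lambda$ with a part $0$ appended. The definition is extended to all partitions by: (i) if $\tilde\lambda$ is obtained from $\lambda$ by switching adjacent parts $\lambda_i,\lambda_{i+1}$ that are not both $0$, then $Q_{\tilde\lambda}=-Q_\lambda$; (ii) $Q_{(\lambda,0)}=Q_\lambda$ for all $\lambda$; (iii) $Q_\emptyset=1$. $Q_\lambda(\delta_{k,3}/3)$ is the value of $Q_\lambda(\mathbf t)$ at $t_k=\delta_{k,3}/3$ for all $k$. *)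

(* Defs.v *)
From HB Require Import structures.
From mathcomp Require Import all_boot all_order all_algebra perm fingroup.

Set Implicit Arguments.
Unset Strict Implicit.
Unset Printing Implicit Defensive.

Import GRing.Theory.
Local Open Scope ring_scope.

(* Partitions are arbitrary sequences of natural numbers (in any order, with
   zero parts allowed); |lambda| is [sumn lambda]. *)
Definition weakly_positive (lambda : seq nat) : bool :=
  (count_mem 0%N lambda <= 1)%N.

Section Pfaffian.
Variable R : comUnitRingType.

Fact pf_left_subproof m (i : 'I_m) : (i.*2 < m.*2)%N.
Proof. by rewrite ltn_double. Qed.
Fact pf_right_subproof m (i : 'I_m) : (i.*2.+1 < m.*2)%N.
Proof. by rewrite -doubleS leq_double. Qed.

Definition pf_left m (i : 'I_m) : 'I_(m.*2) := Ordinal (pf_left_subproof i).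
Definition pf_right m (i : 'I_m) : 'I_(m.*2) := Ordinal (pf_right_subproof i).

(* The Leibniz-type formula for the Pfaffian of a skew-symmetric matrix. *)
Definition pfaffian m (A : 'M[R]_(m.*2)) : R :=
  ((2 ^ m * m`!)%N%:R)^-1 *
  \sum_(s : 'S_(m.*2))
    (-1) ^+ s * \prod_(i < m) A (s (pf_left i)) (s (pf_right i)).

Lemma pfaffian_perm m (A : 'M[R]_(m.*2)) (u : 'S_(m.*2)) :
  pfaffian (\matrix_(i, j) A (u i) (u j)) = (-1) ^+ u * pfaffian A.
Proof.
rewrite /pfaffian mulrCA; congr (_ * _); rewrite big_distrr /=.
rewrite [RHS](reindex_inj (mulIg u)) /=; apply: eq_bigr => s _.
rewrite mulrA -signr_addb odd_permM addbC addbK; congr (_ * _).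
by apply: eq_bigr => i _; rewrite mxE !permM.
Qed.

End Pfaffian.

Section SchurQ.
Variable R : comUnitRingType.

(* The variables (t_1, t_3, t_5, ...) are given by t : nat -> R, of which only
   the values at odd indices are used.  The positive integers are meant to be
   invertible in R; the polynomials themselves are obtained when R is a
   polynomial ring over rat and the t_k are its variables. *)
Variable t : nat -> R.

(* Coefficient of z^k in exp(2 * sum_(i odd) t_i z^i).  That series has no
   constant term, so the terms of degree > k and the powers of exponent > k
   do not contribute. *)
Definition schur_q (k : nat) : R :=
  (\sum_(j < k.+1)
     (j`!%:R)^-1 *:
     (2%:R *: \poly_(i < k.+1) (if odd i then t i else 0)) ^+ j)`_k.

Definition schurM (r s : nat) : R :=
  if (r == 0%N) && (s == 0%N) then 0
  else schur_q r * schur_q s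
       + 2%:R * \sum_(1 <= i < s.+1)
                  (-1) ^+ i * schur_q (r + i) * schur_q (s - i).

(* Only meant for lambda of even length. *)
Definition schurPf (lambda : seq nat) : R :=
  pfaffian (\matrix_(i < (size lambda)./2.*2, j < (size lambda)./2.*2)
              schurM (nth 0%N lambda i) (nth 0%N lambda j)).

(* The number of pairs i < j with lambda_i = 0 and lambda_j > 0, i.e. of
   adjacent switches needed to move all the zero parts to the end. *)
Fixpoint zero_inv (lambda : seq nat) : nat :=
  if lambda is x :: mu then
    ((if x == 0 then count (leq 1) mu else 0) + zero_inv mu)%N
  else 0%N.

(* The last branch implements the extension to all partitions: move the zeros
   to the end with sign changes and drop them.  Lemmas [schurQ_switch],
   [schurQ_rcons0] and [schurQ_unique] below show that this is the unique
   extension with the required properties. *)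
Definition schurQ (lambda : seq nat) : R :=
  if weakly_positive lambda && ~~ odd (size lambda) then schurPf lambda
  else if 0%N \notin lambda then schurPf (rcons lambda 0%N)
  else let mu := filter (leq 1) lambda in
       (-1) ^+ zero_inv lambda *
       (if odd (size mu) then schurPf (rcons mu 0%N) else schurPf mu).

Definition switch_rule (F : seq nat -> R) : Prop :=
  forall a x y b, (0 < x + y)%N -> F (a ++ y :: x :: b) = - F (a ++ x :: y :: b).

Definition zero_rule (F : seq nat -> R) : Prop :=
  forall lambda, F (rcons lambda 0%N) = F lambda.

Lemma schurPf_switch a x y b : ~~ odd (size (a ++ x :: y :: b)) ->
  schurPf (a ++ y :: x :: b) = - schurPf (a ++ x :: y :: b).
Proof.
move=> ev; rewrite /schurPf.
have -> : size (a ++ y :: x :: b) = size (a ++ x :: y :: b) by rewrite !size_cat.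
move: ev; set l := a ++ x :: _; set m := (size l)./2 => ev.
have sz : m.*2 = size l by rewrite -[RHS]odd_double_half (negbTE ev).
have h1 : (size a < m.*2)%N by rewrite sz size_cat /= -addSnnS leq_addr.
have h2 : ((size a).+1 < m.*2)%N by rewrite sz size_cat /= !addnS !ltnS leq_addr.
pose u := tperm (Ordinal h1) (Ordinal h2).
rewrite -[- _]mulN1r.
have <- : (-1) ^+ u = -1 :> R by rewrite odd_tperm -val_eqE /= neq_ltn ltnSn.
rewrite -pfaffian_perm; congr pfaffian; apply/matrixP => i j; rewrite !mxE.
suff E (c : 'I_(m.*2)) : nth 0%N (a ++ y :: x :: b) c = nth 0%N l (u c).
  by rewrite !E.
rewrite /u; case: tpermP => [->|->|/eqP n1 /eqP n2] /=.
- by rewrite !nth_cat /= ltnn subnn ltnNge leqnSn subSnn.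
- by rewrite !nth_cat /= ltnn subnn ltnNge leqnSn subSnn.
move: n1 n2; rewrite -!val_eqE /= !nth_cat; case: ltnP => // le n1 n2.
have: (1 < c - size a)%N.
  by rewrite ltn_subRL addn1 ltn_neqAle eq_sym n2 ltn_neqAle eq_sym n1.
by case: (c - size a)%N => [|[|?]].
Qed.

Lemma zero_inv_switch a x y b : (0 < x + y)%N ->
  (-1) ^+ zero_inv (a ++ y :: x :: b) =
  (if (0 < x)%N && (0 < y)%N then 1 else -1) *
  (-1) ^+ zero_inv (a ++ x :: y :: b) :> R.
Proof.
move=> xy; elim: a => [|z a IH] /=; last first.
  rewrite !exprD IH !count_cat /= mulrCA; congr (_ * (_ ^+ _ * _)).
  by case: eqP => // _; rewrite (addnCA (0 < x)%N).
case: x y xy => [|x] [|y] //= _; rewrite ?mul1r ?addn0 ?add0n ?add1n //.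
  by rewrite addSn exprS mulN1r mulN1r opprK.
by rewrite addSn exprS mulN1r.
Qed.

Lemma filter_switch a x y b : (x == 0%N) || (y == 0%N) ->
  filter (leq 1) (a ++ y :: x :: b) = filter (leq 1) (a ++ x :: y :: b).
Proof. by rewrite !filter_cat; case: x => [|x]; case: y. Qed.

Lemma switch_move0 (F : seq nat -> R) (P : pred nat) a b :
    (forall a x b, P (size (a ++ 0%N :: x :: b)) -> (0 < x)%N ->
       F (a ++ 0%N :: x :: b) = - F (a ++ x :: 0%N :: b)) ->
    P (size (a ++ 0%N :: b)) -> all (leq 1) b ->
  F (a ++ 0%N :: b) = (-1) ^+ size b * F (rcons (a ++ b) 0%N).
Proof.
move=> sw; elim: b a => [|x b IH] a Pab; first by rewrite mul1r cats0 cats1.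
case/andP=> x0 b0; rewrite sw // -[a ++ x :: _]cat_rcons IH //.
  by rewrite cat_rcons exprS mulN1r mulNr.
by move: Pab; rewrite !size_cat size_rcons /= addSnnS.
Qed.

Lemma switch_zero_ruleE F lambda : switch_rule F -> zero_rule F ->
  F lambda = (-1) ^+ zero_inv lambda * F (filter (leq 1) lambda).
Proof.
move=> sw z; rewrite -[lambda in LHS]cat0s -[filter _ _]cat0s.
elim: lambda [::] => [|[|x] s IH] a /=; first by rewrite mul1r.
  rewrite -cat_rcons IH cat_rcons exprD -mulrA mulrCA; congr (_ * _).
  rewrite (@switch_move0 _ predT) ?filter_all // ?size_filter ?z //.
  by move=> a' x b' _ x0; rewrite (sw a' x) ?addn0.
by rewrite -cat_rcons IH cat_rcons.
Qed.

Lemma zero_inv_pos lambda : 0%N \notin lambda -> zero_inv lambda = 0%N.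
Proof. by elim: lambda => //= x s IH; rewrite inE => /norP[]; case: x. Qed.

Lemma filter_pos lambda : 0%N \notin lambda -> filter (leq 1) lambda = lambda.
Proof.
by move=> l0; apply/all_filterP/allP => -[|x] //; rewrite (negbTE l0).
Qed.

Let schurQpos mu : R :=
  if odd (size mu) then schurPf (rcons mu 0%N) else schurPf mu.

Lemma schurQE lambda :
  schurQ lambda = (-1) ^+ zero_inv lambda * schurQpos (filter (leq 1) lambda).
Proof.
rewrite /schurQ /schurQpos; have [l0|l0] /= := boolP (0%N \in lambda); last first.
  rewrite zero_inv_pos // filter_pos // mul1r /weakly_positive.
  by rewrite (count_memPn l0) /=; case: odd.
case: ifP => // /andP[]; rewrite /weakly_positive.
case/splitPr: l0 => a b; rewrite count_cat /= add1n addnS ltnS leqn0 addn_eq0.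
case/andP=> /eqP/count_memPn a0 /eqP/count_memPn b0 ev.
have -> : zero_inv (a ++ 0%N :: b) = size b.
  elim: a a0 {ev} => [|x a IH] /=; last first.
    by rewrite inE => /norP[]; case: x => // x _ /IH.
  rewrite zero_inv_pos // addn0; move/filter_pos: b0 => {2}<-.
  by rewrite size_filter.
rewrite filter_cat /= !filter_pos //.
have -> : odd (size (a ++ b)).
  by move: ev; rewrite !size_cat addnS /= negbK.
apply: (@switch_move0 schurPf (fun n => ~~ odd n)) => //; last first.
  by apply/allP => -[|x] //; rewrite (negbTE b0).
move=> a' x b' ev' _; apply: schurPf_switch; move: ev'.
by rewrite !size_cat.
Qed.

Lemma schurQ_switch : switch_rule schurQ.
Proof.
move=> a x y b xy; rewrite !schurQE zero_inv_switch //.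
case: ifP => [/andP[x0 y0] | xy0]; last first.
  rewrite filter_switch ?mulN1r ?mulNr //.
  by move: xy0; rewrite !lt0n -negb_or => /negbFE.
rewrite mul1r -mulrN; congr (_ * _); rewrite !filter_cat /= x0 y0 /schurQpos.
set a' := filter _ a; set b' := filter _ b.
have -> : size (a' ++ y :: x :: b') = size (a' ++ x :: y :: b').
  by rewrite !size_cat.
case: ifP => o; last by rewrite schurPf_switch ?o.
by rewrite !rcons_cat /= schurPf_switch // -!rcons_cons -rcons_cat size_rcons /= o.
Qed.

Lemma schurQ_rcons0 : zero_rule schurQ.
Proof.
move=> l; rewrite !schurQE filter_rcons /=; congr (_ ^+ _ * _).
elim: l => //= x l ->; rewrite -cats1 count_cat /=.
by rewrite !addn0.
Qed.

Lemma schurQ_nil : schurQ [::] = 1.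
Proof.
rewrite /schurQ /schurPf /pfaffian /= (big_pred1 1%g) => [|s].
  by rewrite odd_perm1 big_ord0 !mulr1 invr1.
by apply/esym/eqP/permP => -[].
Qed.

Lemma schurQ_unique (F : seq nat -> R) :
    (forall lambda, weakly_positive lambda -> ~~ odd (size lambda) ->
       F lambda = schurPf lambda) ->
    switch_rule F -> zero_rule F ->
  F =1 schurQ.
Proof.
move=> Fpf Fsw F0 l; rewrite schurQE switch_zero_ruleE //; congr (_ * _).
have cl : count_mem 0%N (filter (leq 1) l) = 0%N.
  by apply/count_memPn; rewrite mem_filter.
rewrite /schurQpos; case: ifP => o; last by rewrite Fpf ?o // /weakly_positive cl.
rewrite -F0 Fpf ?size_rcons /= ?o //.
by rewrite /weakly_positive -cats1 count_cat cl.
Qed.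

End SchurQ.

(* Main.v *)
(** At the specialization [t_k = delta_(k,3) / 3] only the [q_(3a)] survive, with
    [q_(3a) = (2/3)^a / a!], and an alternating sum evaluates the entries: up to
    the factors [q_(3 floor(x/3))], [M_(3a,3b)] is [(a - b) / (a + b)],
    [M_(3a+1,3b+2)] is [(4/3) / (a + b + 1)], and the entries whose indices do
    not add up to a multiple of 3 vanish.  The Pfaffian is thus the product of
    a Schur Pfaffian, in the [k_i], and a Cauchy determinant, in the [m_i] and
    [n_i].  Both are computed by the same Gaussian elimination: the identity
    [pf (L A L^T) = det L pf A] allows one to clear the first two rows, which
    replaces [A i j] by the 4 x 4 Pfaffian on [0, 1, i, j] divided by [A 0 1].
    For both kinds of entries this quotient is [g i * g j * A i j] for an
    explicit [g], so that the remaining Pfaffian is of the same form with two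
    indices less. *)

Require Import Defs.
From mathcomp Require Import all_boot all_order all_algebra perm fingroup.
From mathcomp Require Import ring zify.
Set Implicit Arguments.
Unset Strict Implicit.
Unset Printing Implicit Defensive.
Import Order.TTheory GRing.Theory Num.Theory.
Local Open Scope ring_scope.

(** * Pfaffians under congruence *)

Lemma prod_ord_double (R : comNzRingType) m (F : 'I_m.*2 -> R) :
  \prod_(j < m.*2) F j = \prod_(i < m) (F (pf_left i) * F (pf_right i)).
Proof.
elim: m F => [|m IH] F; first by rewrite !big_ord0.
rewrite [RHS]big_ord_recl -mulrA; rewrite -[LHS]/(\prod_(j < m.*2.+2) F j).
rewrite big_ord_recl; congr (_ * _); first by congr (F _); apply: val_inj.
rewrite big_ord_recl; congr (_ * _); first by congr (F _); apply: val_inj.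
rewrite (IH (fun j => F (lift ord0 (lift ord0 j)))).
by apply: eq_bigr => i _; congr (F _ * F _); apply: val_inj.
Qed.

Section Congruence.
Variables (R : comUnitRingType) (m : nat).
Implicit Types A L : 'M[R]_(m.*2).

Fact half_ord_subproof (j : 'I_m.*2) : (j./2 < m)%N.
Proof. by rewrite ltn_half_double. Qed.
Definition half_ord j : 'I_m := Ordinal (half_ord_subproof j).

(** Flattens one index pair per edge of the matching into a single index function on all positions,
    so that it can select columns of a matrix. *)
Definition unpair (f : 'I_m -> 'I_m.*2 * 'I_m.*2) (j : 'I_m.*2) : 'I_m.*2 :=
  if odd j then (f (half_ord j)).2 else (f (half_ord j)).1.

Lemma unpair_left f i : unpair f (pf_left i) = (f i).1.
Proof.
rewrite /unpair /= odd_double; congr (f _).1.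
by apply: val_inj; rewrite /= doubleK.
Qed.

Lemma unpair_right f i : unpair f (pf_right i) = (f i).2.
Proof.
rewrite /unpair /= odd_double; congr (f _).2.
by apply: val_inj; rewrite /= uphalf_double.
Qed.

(* The product over the matching is expanded as a sum over all index functions
   [f]; by [det_mulmx], [L] enters each summand only through [\det L]. *)
Lemma pfaffian_congr L A : pfaffian (L *m A *m L^T) = \det L * pfaffian A.
Proof.
pose P L := \sum_(s : 'S_(m.*2)) (-1) ^+ s *
  \prod_(i < m) (L *m A *m L^T) (s (pf_left i)) (s (pf_right i)).
pose S := \sum_(f : {ffun 'I_m -> 'I_m.*2 * 'I_m.*2})
  (\prod_i A (f i).1 (f i).2) * \det (colsub (unpair f) (1%:M : 'M[R]_(m.*2))).
have PE B : P B = \det B * S.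
  rewrite /P; under eq_bigr => s _.
    under eq_bigr => i _.
      rewrite -mulmxA mxE; under eq_bigr => l _ do rewrite mxE mulr_sumr.
      rewrite pair_bigA /=.
      over.
    rewrite bigA_distr_bigA mulr_sumr /=.
    over.
  rewrite exchange_big /S mulr_sumr; apply: eq_bigr => f _ /=.
  rewrite mulrCA -det_mulmx mulmx_colsub mulmx1 -det_tr mulr_sumr.
  apply: eq_bigr => s _; rewrite mulrCA [in RHS]prod_ord_double; congr (_ * _).
  rewrite -big_split; apply: eq_bigr => i _ /=.
  by rewrite !mxE unpair_left unpair_right mulrCA.
rewrite /pfaffian -/(P L) PE.
(* [S] does not depend on [L], so taking [L = 1] identifies it. *)
have -> : S = P 1%:M by rewrite PE det1 mul1r.
by rewrite mulrCA; congr (_ * (_ * _)); rewrite /P mul1mx trmx1 mulmx1.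
Qed.
End Congruence.

Section PfaffianOps.
Variables (R : comUnitRingType) (m : nat).
Implicit Type A : 'M[R]_(m.*2).

Lemma pfaffian_scale (d : 'rV[R]_(m.*2)) A :
  pfaffian (\matrix_(i, j) (d 0 i * d 0 j * A i j)) =
  (\prod_i d 0 i) * pfaffian A.
Proof.
rewrite -det_diag -pfaffian_congr tr_diag_mx; congr pfaffian.
by apply/matrixP => i j; rewrite mul_mx_diag mul_diag_mx !mxE mulrAC.
Qed.

(** Scaling the index [i0] by 0 leaves [A] unchanged but multiplies its Pfaffian by 0. *)
Lemma pfaffian_zero_row A i0 :
  (forall j, A i0 j = 0) -> (forall j, A j i0 = 0) -> pfaffian A = 0.
Proof.
move=> row0 col0; pose d : 'rV[R]_(m.*2) := \row_j (j != i0)%:R.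
have -> : A = \matrix_(i, j) (d 0 i * d 0 j * A i j).
  apply/matrixP => i j; rewrite !mxE.
  have [->|_] := eqVneq i i0; first by rewrite row0 mulr0.
  by have [->|_] := eqVneq j i0; rewrite ?col0 ?mulr0 // !mul1r.
by rewrite pfaffian_scale (bigD1 i0) //= mxE eqxx !mul0r.
Qed.
End PfaffianOps.

(** * Expansion of a Pfaffian along a row with one nonzero entry *)

Lemma pf_left_eq n (i j : 'I_n) : (pf_left i == pf_left j) = (i == j).
Proof. by rewrite -!val_eqE /= (inj_eq double_inj). Qed.

Lemma pf_right_eq n (i j : 'I_n) : (pf_right i == pf_right j) = (i == j).
Proof. by rewrite -!val_eqE /= eqSS (inj_eq double_inj). Qed.

Lemma pf_left_neq_right n (i j : 'I_n) : pf_left i != pf_right j.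
Proof.
by apply/eqP => /(congr1 (odd \o val)); rewrite /= !odd_double.
Qed.

Lemma pf_right_neq_left n (i j : 'I_n) : pf_right i != pf_left j.
Proof. by rewrite eq_sym pf_left_neq_right. Qed.

Variant pf_ord_spec n : 'I_(n.*2) -> Type :=
  | PfLeft i : pf_ord_spec (pf_left i)
  | PfRight i : pf_ord_spec (pf_right i).

Lemma pf_ordP n (j : 'I_(n.*2)) : pf_ord_spec j.
Proof.
have [o|o] := boolP (odd j).
  suff -> : j = pf_right (half_ord j) by constructor.
  by apply: val_inj; rewrite /= -[LHS]odd_double_half o.
suff -> : j = pf_left (half_ord j) by constructor.
by apply: val_inj; rewrite /= -[LHS]odd_double_half (negbTE o).
Qed.

Lemma reindex_lift_perm (V : nmodType) n (i j : 'I_n.+1) (F : 'S_n.+1 -> V) :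
  \sum_(s : 'S_n.+1 | s i == j) F s = \sum_s F (lift_perm i j s).
Proof.
(* The inverse of [lift_perm i j] deletes [i] and its image; the default of [odflt] is never
   reached, as [s (lift i k)] differs from [s i]. *)
have injf (s : {perm 'I_n.+1}) :
    injective (fun k => odflt k (unlift (s i) (s (lift i k)))).
  move=> k l; have E k' : exists x, unlift (s i) (s (lift i k')) = Some x
      /\ s (lift i k') = lift (s i) x.
    have := neq_lift i k'; rewrite -(inj_eq (@perm_inj _ s)).
    by case/unlift_some => x E1 E2; exists x.
  have [x [-> Ex]] := E k; have [y [-> Ey]] := E l => /= xy.
  by move: Ex; rewrite xy -Ey => /perm_inj/lift_inj.
rewrite (reindex (lift_perm i j)) /=.
  by apply: eq_bigl => s; rewrite lift_perm_id eqxx.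
exists (fun s => perm (injf s)) => [s _ | s].
  by apply/permP => k; rewrite permE lift_perm_id lift_perm_lift liftK.
rewrite inE => /eqP si; apply/permP => k.
case: (unliftP i k) => [l|] ->; rewrite ?lift_perm_id //.
rewrite lift_perm_lift permE -si; have := neq_lift i l.
by rewrite -(inj_eq (@perm_inj _ s)) => /unlift_some[x Ex ->].
Qed.

Section Expansion.
Variable R : numFieldType.

Let pfterm n (A : 'M[R]_(n.*2)) (s : 'S_(n.*2)) : R :=
  (-1) ^+ s * \prod_(i < n) A (s (pf_left i)) (s (pf_right i)).

(** The sign of the transposition cancels the sign from skew-symmetry. *)
Let pfterm_swap n (A : 'M[R]_(n.*2)) s i :
    (forall i j, A i j = - A j i) ->
  pfterm A (tperm (pf_left i) (pf_right i) * s) = pfterm A s.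
Proof.
move=> skewA; rewrite /pfterm odd_mul_tperm pf_left_neq_right.
rewrite signr_addb mulN1r mulNr -mulrN; congr (_ * _).
rewrite (bigD1 i) //= [in RHS](bigD1 i) //= -mulNr; congr (_ * _).
  by rewrite !permM tpermL tpermR [in RHS]skewA.
apply: eq_bigr => j ji; rewrite !permM !tpermD //.
all: rewrite ?(pf_left_neq_right, pf_right_neq_left) //.
all: by rewrite ?(pf_left_eq, pf_right_eq) eq_sym.
Qed.

Let swap_pairs n (i j : 'I_n) : 'S_(n.*2) :=
  (tperm (pf_left i) (pf_left j) * tperm (pf_right i) (pf_right j))%g.

Let swap_pairs_left n (i j k : 'I_n) :
  swap_pairs i j (pf_left k) = pf_left (tperm i j k).
Proof.
rewrite permM; case: (tpermP i j k) => [->|->|/eqP ki /eqP kj].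
- by rewrite tpermL tpermD ?pf_right_neq_left.
- by rewrite tpermR tpermD ?pf_right_neq_left.
have -> : tperm (pf_left i) (pf_left j) (pf_left k) = pf_left k.
  by rewrite tpermD // pf_left_eq eq_sym.
by rewrite tpermD ?pf_right_neq_left.
Qed.

Let swap_pairs_right n (i j k : 'I_n) :
  swap_pairs i j (pf_right k) = pf_right (tperm i j k).
Proof.
rewrite permM.
have -> : tperm (pf_left i) (pf_left j) (pf_right k) = pf_right k.
  by rewrite tpermD ?pf_left_neq_right.
case: (tpermP i j k) => [->|->|/eqP ki /eqP kj]; rewrite ?tpermL ?tpermR //.
by rewrite tpermD ?pf_right_eq // eq_sym.
Qed.

(** Exchanging two whole edges of the matching is an even permutation and merely reorders the
    factors. *)
Let pfterm_swap_pairs n (A : 'M[R]_(n.*2)) s i j :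
  pfterm A (swap_pairs i j * s) = pfterm A s.
Proof.
rewrite /pfterm !odd_permM !odd_tperm pf_left_eq pf_right_eq addbb.
congr (_ * _); rewrite [RHS](reindex_inj (@perm_inj _ (tperm i j))).
apply: eq_bigr => k _ /=.
by rewrite permM swap_pairs_left permM swap_pairs_right.
Qed.

(* [pfterm A] is invariant under the permutations of positions that preserve
   the matching of left and right positions; these act transitively. *)
Let pfterm_sum_at n (A : 'M[R]_(n.+1.*2)) j :
    (forall i j, A i j = - A j i) ->
  \sum_(s : 'S_(n.+1.*2) | s j == pf_left ord0) pfterm A s =
  \sum_(s : 'S_(n.+1.*2) | s (pf_left ord0) == pf_left ord0) pfterm A s.
Proof.
move=> skewA; have toL i :
    \sum_(s : 'S_(n.+1.*2) | s (pf_left i) == pf_left ord0) pfterm A s =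
    \sum_(s : 'S_(n.+1.*2) | s (pf_left ord0) == pf_left ord0) pfterm A s.
  rewrite (reindex_inj (mulgI (swap_pairs i ord0))) /=.
  apply: eq_big => s; last by rewrite pfterm_swap_pairs.
  by rewrite permM swap_pairs_left tpermL.
case: (pf_ordP j) => i //; rewrite -(toL i).
rewrite (reindex_inj (mulgI (tperm (pf_left i) (pf_right i)))) /=.
by apply: eq_big => s; rewrite ?pfterm_swap // permM tpermR.
Qed.

Definition lift2 n (i : 'I_(n.*2)) : 'I_(n.+1.*2) :=
  lift (ord0 : 'I_n.*2.+2) (lift ord0 i).

(** A summand survives only if it also fixes the second position; removing the two fixed points one
    after the other does not change the sign. *)
Let pfterm_sum_expand n (A : 'M[R]_(n.+1.*2)) :
    (forall j, j != pf_right ord0 -> A (pf_left ord0) j = 0) ->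
  \sum_(s : 'S_(n.+1.*2) | s (pf_left ord0) == pf_left ord0) pfterm A s =
  A (pf_left ord0) (pf_right ord0) *
  \sum_(s : 'S_(n.*2)) pfterm (\matrix_(i, j) A (lift2 i) (lift2 j)) s.
Proof.
move=> A0.
have L0 : pf_left (ord0 : 'I_n.+1) = (ord0 : 'I_n.*2.+2) by apply: val_inj.
have R0 : pf_right (ord0 : 'I_n.+1) = lift (ord0 : 'I_n.*2.+2) ord0.
  by apply: val_inj.
rewrite (bigID (fun s : 'S_(n.+1.*2) => s (pf_right ord0) == pf_right ord0)) /=.
rewrite addrC big1 ?add0r => [|s /andP[/eqP s0 s1]]; last first.
  by rewrite /pfterm big_ord_recl s0 A0 // mul0r mulr0.
rewrite big_mkcondr L0 R0.
rewrite (@reindex_lift_perm _ n.*2.+1 ord0 ord0).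
rewrite -big_mkcond /=.
under eq_bigl => s do rewrite lift_perm_lift (inj_eq lift_inj).
rewrite reindex_lift_perm mulr_sumr; apply: eq_bigr => s _.
rewrite /pfterm mulrCA !odd_lift_perm /=; congr (_ * _).
rewrite big_ord_recl; congr (_ * _).
  by rewrite L0 R0 lift_perm_id lift_perm_lift lift_perm_id.
apply: eq_bigr => i _; rewrite mxE.
have -> : pf_left (lift ord0 i) = lift2 (pf_left i) by apply: val_inj.
have -> : pf_right (lift ord0 i) = lift2 (pf_right i) by apply: val_inj.
by rewrite /lift2 !lift_perm_lift.
Qed.

Lemma pfaffian_split n (A : 'M[R]_(n.+1.*2)) :
    (forall i j, A i j = - A j i) ->
    (forall j, j != pf_right ord0 -> A (pf_left ord0) j = 0) ->
  pfaffian A = A (pf_left ord0) (pf_right ord0) *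
               pfaffian (\matrix_(i, j) A (lift2 i) (lift2 j)).
Proof.
move=> skewA A0; rewrite /pfaffian mulrCA -pfterm_sum_expand //.
(* Sorting the permutations by the position sent to index 0 gives [2 * n.+1] equal sums, and this
   factor is the ratio of the two normalizations. *)
pose at0 (s : 'S_(n.+1.*2)) := (s^-1)%g (pf_left ord0).
rewrite (partition_big at0 predT) //=.
rewrite (eq_bigr (fun=>
  \sum_(s : 'S_(n.+1.*2) | s (pf_left ord0) == pf_left ord0)
    (-1) ^+ s * \prod_(i < n.+1) A (s (pf_left i)) (s (pf_right i)))); last first.
  move=> j _; rewrite -(pfterm_sum_at j skewA); apply: eq_bigl => s.
  by rewrite /at0 (canF_eq (permK _)) invgK eq_sym.
rewrite sumr_const card_ord /=.
set S := \sum_(s | _) _; rewrite -[S *+ _]mulr_natl mulrA; congr (_ * _).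
rewrite expnS factS -muln2 mulnACA [(2 * n.+1)%N]mulnC natrM.
by rewrite invfM mulrAC mulVf ?mul1r // pnatr_eq0 muln_eq0.
Qed.
End Expansion.

(** * Elimination of a pair of indices *)

Lemma pfaffian_eliminate (R : numFieldType) n (A : 'M[R]_(n.+1.*2)) :
    (forall i j, A i j = - A j i) ->
    A (pf_left ord0) (pf_right ord0) != 0 ->
  pfaffian A = A (pf_left ord0) (pf_right ord0) *
    pfaffian (\matrix_(i, j)
      (A (lift2 i) (lift2 j) +
       (A (pf_left ord0) (lift2 j) * A (pf_right ord0) (lift2 i) -
        A (pf_left ord0) (lift2 i) * A (pf_right ord0) (lift2 j)) /
       A (pf_left ord0) (pf_right ord0))).
Proof.
set o : 'I_(n.+1.*2) := pf_left _; set e : 'I_(n.+1.*2) := pf_right _.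
set a := A o e => skewA a0.
have diagA i : A i i = 0.
  by apply/eqP; have /eqP := skewA i i; rewrite -addr_eq0 -mulr2n mulrn_eq0.
(* Adding [u i] times row [o] and [v i] times row [e] to row [i], and likewise for columns, clears
   the entries of [o] and [e] against all [i > 1]. The factor [1 < i] keeps the first two rows
   fixed, which makes [L] unitriangular. *)
pose u (i : 'I_(n.+1.*2)) : R := (1 < i)%N%:R * A e i / a.
pose v (i : 'I_(n.+1.*2)) : R := - ((1 < i)%N%:R * A o i / a).
pose L : 'M[R]_(n.+1.*2) :=
  \matrix_(i, k) ((i == k)%:R + u i * (k == o)%:R + v i * (k == e)%:R).
have pick1 (i : 'I_(n.+1.*2)) (F : _ -> R) : \sum_k (k == i)%:R * F k = F i.
  rewrite (bigD1 i) //= eqxx mul1r big1 ?addr0 // => k /negbTE->.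
  by rewrite mul0r.
have LF i (F : _ -> R) : \sum_k L i k * F k = F i + u i * F o + v i * F e.
  rewrite -[F i]pick1 -[F o]pick1 -[F e]pick1 !mulr_sumr -!big_split.
  by apply: eq_bigr => k _; rewrite mxE [i == k]eq_sym /=; ring.
have LAL i j : (L *m A *m L^T) i j = A i j + u i * A o j + v i * A e j
    + u j * (A i o + v i * A e o) + v j * (A i e + u i * A o e).
  have -> : (L *m A *m L^T) i j = \sum_k L i k * \sum_l L j l * A k l.
    rewrite -mulmxA mxE; apply: eq_bigr => k _; rewrite [(A *m _) k j]mxE.
    by congr (_ * _); apply: eq_bigr => l _; rewrite [L^T l j]mxE mulrC.
  by rewrite LF !LF !diagA; ring.
have detL : \det L = 1.
  rewrite det_trig; last first.
    apply/is_trig_mxP => i j ij; rewrite mxE -!val_eqE /= (ltn_eqF ij) /u /v.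
    by case: j ij => -[|[|j]] ? //=; case: i => -[|i] ? //= _;
      rewrite ?ltnn; ring.
  rewrite big1 // => i _; rewrite mxE eqxx -!val_eqE /= /u /v.
  by case: i => -[|[|i]] ? /=; ring.
rewrite -[LHS]mul1r -detL -pfaffian_congr pfaffian_split; first last.
- move=> j; rewrite LAL -/o -/e -/a (skewA e o) diagA -/a.
  case: (ltnP 1 j) => [j1 _|]; first by rewrite /u /v j1 /=; field.
  case: j => -[|[|j]] Hj //= _ _.
  have -> : Ordinal Hj = o by apply: val_inj.
  by rewrite diagA /u /v /= !(mul0r, mulr0, oppr0, addr0).
- by move=> i j; rewrite !LAL (skewA i j) (skewA i o) (skewA i e) (skewA j o)
    (skewA j e) (skewA e o); ring.
rewrite LAL -/o -/e -/a !diagA /u /v /= !(mul0r, mulr0, oppr0, addr0).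
congr (_ * pfaffian _).
apply/matrixP => i j; rewrite mxE LAL [RHS]mxE /u /v /=.
by rewrite (skewA (lift2 i) o) (skewA (lift2 i) e) (skewA e o) -/a; field.
Qed.

Section Elimination.
Variables (R : numFieldType) (t : nat -> R).
Hypothesis schurM_skew : forall x y, schurM t x y = - schurM t y x.

Lemma prod_half_double (s : seq nat) (g : nat -> R) : ~~ odd (size s) ->
  \prod_(i < (size s)./2.*2) g (nth 0%N s i) = \prod_(x <- s) g x.
Proof.
move=> ev; rewrite -(big_mkord predT (fun i => g (nth 0%N s i))) even_halfK //.
by rewrite -(big_nth _ predT).
Qed.

(** The left-hand side of the last hypothesis is the 4 by 4 Pfaffian on [x, y, i, j], so after
    elimination the remaining matrix is the old one scaled by [g]. It is required only on members of
    [s], where denominators can be controlled. *)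
Lemma schurPf_eliminate x y s (g : nat -> R) : ~~ odd (size s) ->
    schurM t x y != 0 ->
    {in s &, forall i j,
      schurM t x y * schurM t i j + schurM t x j * schurM t y i
        - schurM t x i * schurM t y j =
      schurM t x y * (g i * g j * schurM t i j)} ->
  schurPf t (x :: y :: s) =
  schurM t x y * \prod_(i <- s) g i * schurPf t s.
Proof.
move=> ev Mxy0 E; rewrite {1}/schurPf.
rewrite (@pfaffian_eliminate R (size s)./2); first last.
- by rewrite !mxE.
- by move=> i j; rewrite !mxE schurM_skew.
rewrite !mxE /= -mulrA; congr (_ * _).
rewrite -(prod_half_double g ev).
pose d : 'rV[R]_((size s)./2.*2) := \row_i g (nth 0%N s i).
rewrite [X in X * _](eq_bigr (d 0)) => [|i _]; last by rewrite mxE.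
rewrite -pfaffian_scale; congr pfaffian; apply/matrixP => i j; rewrite !mxE /=.
have ins (k : 'I_((size s)./2.*2)) : nth 0%N s k \in s.
  by rewrite mem_nth // -[X in (_ < X)%N](even_halfK ev).
apply: (mulfI Mxy0); rewrite -E // mulrDr mulrCA divff // mulr1.
by rewrite addrA.
Qed.

Lemma schurPf_null_row a x b : ~~ odd (size (a ++ x :: b)) ->
  {in a ++ x :: b, forall y, schurM t x y = 0} -> schurPf t (a ++ x :: b) = 0.
Proof.
move=> ev x0; have sz := even_halfK ev.
have ha : (size a < (size (a ++ x :: b))./2.*2)%N.
  by rewrite sz size_cat /= -addSnnS leq_addr.
have ins (k : 'I_((size (a ++ x :: b))./2.*2)) :
    schurM t x (nth 0%N (a ++ x :: b) k) = 0.
  by apply: x0; rewrite mem_nth // -[X in (_ < X)%N]sz.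
have nthx : nth 0%N (a ++ x :: b) (size a) = x by rewrite nth_cat ltnn subnn.
apply: (@pfaffian_zero_row _ _ _ (Ordinal ha)) => j; rewrite mxE /= nthx.
  exact: ins.
by rewrite schurM_skew ins oppr0.
Qed.

Lemma schurPf_repeat a x b : ~~ odd (size (a ++ x :: x :: b)) ->
  schurPf t (a ++ x :: x :: b) = 0.
Proof.
move=> /(schurPf_switch t)/eqP.
by rewrite -addr_eq0 -mulr2n mulrn_eq0 => /eqP.
Qed.

Lemma schurPf_move a b x c : ~~ odd (size (a ++ b ++ x :: c)) ->
  schurPf t (a ++ b ++ x :: c) = (-1) ^+ size b * schurPf t (a ++ x :: b ++ c).
Proof.
elim: b a => [|y b IH] a ev; first by rewrite mul1r.
rewrite -[a ++ (y :: b) ++ _](cat_rcons y a) IH ?cat_rcons // schurPf_switch.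
  by rewrite exprS mulN1r mulrN mulNr.
by move: ev; rewrite !size_cat /= size_cat /= !addnS !addnA.
Qed.
End Elimination.

(** * The matrix entries at the specialization *)

Definition t3 (j : nat) : rat := (j == 3%N)%:R / 3%:R.
(** The coefficient of [w^a] in [exp(2w/3)], where [w = z^3]. *)
Definition expq (a : nat) : rat := (2%:R / 3%:R) ^+ a / (a`!)%:R.

Lemma expqS a : expq a.+1 * (a.+1)%:R = 2%:R / 3%:R * expq a.
Proof.
rewrite /expq exprS factS natrM.
have : (a`!)%:R != 0 :> rat by rewrite pnatr_eq0 -lt0n fact_gt0.
have : a.+1%:R != 0 :> rat by rewrite pnatr_eq0.
by move=> h1 h2; field; rewrite h2 nat1r h1.
Qed.

Lemma expq_neq0 a : expq a != 0.
Proof.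
by rewrite mulf_neq0 ?invr_neq0 ?pnatr_eq0 -?lt0n ?fact_gt0 ?expf_neq0.
Qed.

Lemma schur_q3E k : schur_q t3 k =
  if (3 %| k)%N then expq (k %/ 3) else 0.
Proof.
(* The exponent is truncated at degree [k], hence is 0 for [k < 3]. *)
pose p : {poly rat} := (3 <= k)%N%:R * (2%:R / 3%:R) *: 'X^3.
have pE : 2%:R *: \poly_(i < k.+1) (if odd i then t3 i else 0) = p.
  apply/polyP => i; rewrite !coefZ coef_poly coefXn ltnS.
  have [->|ni] := eqVneq i 3%N; last first.
    by rewrite /t3 (negbTE ni) mul0r !if_same !mulr0.
  by rewrite /t3 /=; case: leqP; rewrite ?mulr0 ?mul0r ?mul1r ?mulr1.
have coefp j : (p ^+ j)`_k = ((3 * j)%N == k)%:R * (2%:R / 3%:R) ^+ j.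
  rewrite exprZn -exprM coefZ coefXn [k == _]eq_sym [_ * (_ == _)%:R]mulrC.
  case: eqP => [jk|]; last by rewrite !mul0r.
  rewrite !mul1r; case: j jk => [|j] jk; first by rewrite !expr0.
  by rewrite exprMn -jk leq_pmulr // expr1n mul1r.
rewrite /schur_q pE coef_sum.
under eq_bigr => j _ do rewrite coefZ coefp.
case: ifP => [/dvdnP[a ->] | k3]; last first.
  rewrite big1 // => j _; case: eqP => [jk|]; rewrite ?mul0r ?mulr0 //.
  by case/negP: (negbT k3); apply/dvdnP; exists (j : nat); rewrite mulnC.
rewrite mulnK // mulnC.
have ha : (a < (3 * a).+1)%N by rewrite ltnS leq_pmull.
rewrite (bigD1 (Ordinal ha)) //= eqxx mul1r big1 ?addr0 => [|j].
  by rewrite mulrC.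
by rewrite -val_eqE /= eqn_mul2l => /negbTE->; rewrite mul0r mulr0.
Qed.

Lemma schur_q3M a : schur_q t3 (3 * a) = expq a.
Proof. by rewrite schur_q3E dvdn_mulr // mulKn. Qed.

(** In every product of two [schur_q] in the entry the indices add up to [x + y], so they are not
    both multiples of 3. *)
Lemma schurM3_0 x y : ~~ (3 %| x + y)%N -> schurM t3 x y = 0.
Proof.
move=> nxy; rewrite /schurM.
have q0 u v : ~~ (3 %| u + v)%N -> schur_q t3 u * schur_q t3 v = 0.
  rewrite !schur_q3E; case: ifP => u3; last by rewrite mul0r.
  by case: ifP => v3; rewrite ?mulr0 // dvdn_add.
rewrite q0 // [in X in 2%:R * X]big_nat big1 ?mulr0 ?addr0 ?if_same //.
by move=> i hi; rewrite -mulrA q0 ?mulr0 //; lia.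
Qed.

Lemma sum_nat_3M (F : nat -> rat) n :
  \sum_(0 <= i < 3 * n) F i =
  \sum_(j < n) (F (3 * j)%N + F (3 * j).+1 + F (3 * j).+2).
Proof.
elim: n => [|n IH]; first by rewrite big_geq // big_ord0.
by rewrite mulnS !addSn !add0n !big_nat_recr //= IH big_ord_recr /= -!addrA.
Qed.

(* Splitting off the first term leaves the negated sum for [(a + 1, b - 1)], and
   the absorption identity [expqS] closes the induction. *)
Lemma alt_sum_expq a b : (0 < a + b)%N ->
  \sum_(j < b) (-1) ^+ j * expq (a + j.+1) * expq (b - j.+1) =
  expq a * expq b * b%:R / (a + b)%:R.
Proof.
elim: b a => [|b IH] a ab; first by rewrite big_ord0 mulr0 mul0r.
rewrite big_ord_recl /= expr0 mul1r addn1 subn1.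
under eq_bigr => j _.
  rewrite /bump /= add1n subSS exprS mulN1r !mulNr -addSnnS.
  over.
rewrite sumrN /= IH // addSnnS.
have n0 : (a + b.+1)%:R != 0 :> rat by rewrite pnatr_eq0 addnS.
rewrite -[_ * b.+1%:R]mulrA expqS.
have -> : expq a * (2%:R / 3%:R * expq b) = expq a.+1 * a.+1%:R * expq b.
  by rewrite expqS; ring.
move: n0; rewrite natrD -!natr1 => n0; by field.
Qed.

Lemma schur_q3_0 n : ~~ (3 %| n)%N -> schur_q t3 n = 0.
Proof. by rewrite schur_q3E => /negbTE->. Qed.

Lemma sign_3M (R : pzRingType) j : (-1) ^+ (3 * j) = (-1) ^+ j :> R.
Proof. by rewrite -signr_odd oddM /= signr_odd. Qed.

(* At [a = b = 0] the value is the [0 / 0 = 0] of the field. *)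
Lemma schurM3_00 a b : schurM t3 (3 * a) (3 * b) =
  expq a * expq b * ((a%:R - b%:R) / (a%:R + b%:R)).
Proof.
rewrite /schurM !muln_eq0 /=.
have [/andP[/eqP-> /eqP->] | ab] := ifP; first by rewrite subrr mul0r mulr0.
rewrite big_add1 /=.
pose F i := (-1) ^+ i.+1 * schur_q t3 (3 * a + i.+1) *
  schur_q t3 (3 * b - i.+1).
rewrite (sum_nat_3M F).
have -> : \sum_(j < b) (F (3 * j)%N + F (3 * j).+1 + F (3 * j).+2) =
    - (expq a * expq b * b%:R / (a + b)%:R).
  rewrite -alt_sum_expq; last by lia.
  rewrite -sumrN; apply: eq_bigr => j _; have jb := ltn_ord j.
  rewrite /F !(@schur_q3_0 (3 * a + (3 * j).+1))
    ?(@schur_q3_0 (3 * a + (3 * j).+2)) ?mulr0 ?mul0r ?add0r; [|lia|lia].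
  have -> : (3 * j).+3 = (3 * j.+1)%N by lia.
  by rewrite sign_3M -mulnDr -mulnBr !schur_q3M exprS; ring.
rewrite !schur_q3M natrD; field.
by rewrite -natrD pnatr_eq0 addn_eq0 ab.
Qed.

Lemma schurM3_12 a b : schurM t3 (3 * a + 1) (3 * b + 2) =
  expq a * expq b * (4%:R / 3%:R / (a%:R + b%:R + 1)).
Proof.
rewrite /schurM !addn_eq0 /= andbF schur_q3_0 ?mul0r ?add0r; last by lia.
rewrite big_add1 /=.
pose F i := (-1) ^+ i.+1 * schur_q t3 (3 * a + 1 + i.+1) *
  schur_q t3 (3 * b + 2 - i.+1).
(* The range is completed to blocks of three. In the added term the truncated subtraction gives
   [q_0 = 1], but the other index is 1 modulo 3. *)
have -> : \sum_(0 <= i < 3 * b + 2) F i = \sum_(0 <= i < 3 * b.+1) F i.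
  rewrite mulnS addnC [in RHS]big_nat_recr //=.
  rewrite [X in _ + X](_ : _ = 0) ?addr0 //.
  by rewrite /F schur_q3_0 ?mulr0 ?mul0r //; lia.
rewrite sum_nat_3M.
have -> : \sum_(j < b.+1) (F (3 * j)%N + F (3 * j).+1 + F (3 * j).+2) =
    expq a * expq b.+1 * b.+1%:R / (a + b.+1)%:R.
  rewrite -alt_sum_expq ?addnS //; apply: eq_bigr => j _; have jb := ltn_ord j.
  rewrite /F !(@schur_q3_0 (3 * a + _ + (3 * j).+1))
    ?(@schur_q3_0 (3 * a + _ + (3 * j).+3)) ?mulr0 ?mul0r ?add0r ?addr0;
    [|lia|lia].
  have -> : (3 * a + 1 + (3 * j).+2 = 3 * (a + j.+1))%N by lia.
  have -> : (3 * b + 2 - (3 * j).+2 = 3 * (b.+1 - j.+1))%N by lia.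
  by rewrite !schur_q3M !exprS sign_3M; ring.
(* Absorption turns [expq b.+1 * b.+1] into [2/3 * expq b]; with the factor 2 in [schurM] this gives
   4/3. *)
rewrite -[_ * b.+1%:R]mulrA expqS addnS -[(_ + _).+1%:R]natr1 natrD; field.
by rewrite -natrD natr1 pnatr_eq0.
Qed.

Lemma schurM3_21 a b : schurM t3 (3 * b + 2) (3 * a + 1) =
  - (expq a * expq b * (4%:R / 3%:R / (a%:R + b%:R + 1))).
Proof.
rewrite /schurM !addn_eq0 /= andbF schur_q3_0 ?mul0r ?add0r; last by lia.
rewrite big_add1 /=.
pose F i := (-1) ^+ i.+1 * schur_q t3 (3 * b + 2 + i.+1) *
  schur_q t3 (3 * a + 1 - i.+1).
have -> : \sum_(0 <= i < 3 * a + 1) F i = \sum_(0 <= i < 3 * a.+1) F i.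
  rewrite (_ : 3 * a.+1 = (3 * a + 1).+2)%N; last by lia.
  rewrite [in RHS]big_nat_recr // [in RHS]big_nat_recr //=.
  rewrite -addrA [X in _ + X](_ : _ = 0) ?addr0 //.
  rewrite /F (@schur_q3_0 (3 * b + 2 + (3 * a + 1).+1)); last by lia.
  rewrite (@schur_q3_0 (3 * b + 2 + (3 * a + 1).+2)); last by lia.
  by rewrite !mulr0 !mul0r addr0.
rewrite sum_nat_3M.
have -> : \sum_(j < a.+1) (F (3 * j)%N + F (3 * j).+1 + F (3 * j).+2) =
    - (expq b * expq a.+1 * a.+1%:R / (b + a.+1)%:R).
  rewrite -alt_sum_expq ?addnS // -sumrN.
  apply: eq_bigr => j _; have jb := ltn_ord j.
  rewrite /F !(@schur_q3_0 (3 * b + _ + (3 * j).+2))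
    ?(@schur_q3_0 (3 * b + _ + (3 * j).+3)) ?mulr0 ?mul0r ?add0r ?addr0;
    [|lia|lia].
  have -> : (3 * b + 2 + (3 * j).+1 = 3 * (b + j.+1))%N by lia.
  have -> : (3 * a + 1 - (3 * j).+1 = 3 * (a.+1 - j.+1))%N by lia.
  by rewrite !schur_q3M !exprS sign_3M; ring.
rewrite -[_ * a.+1%:R]mulrA expqS addnS -[(_ + _).+1%:R]natr1 natrD; field.
by rewrite -!natrD natr1 addnC pnatr_eq0.
Qed.

Variant mod3_spec : nat -> Type :=
  | Mod3_0 a : mod3_spec (3 * a)
  | Mod3_1 a : mod3_spec (3 * a + 1)
  | Mod3_2 a : mod3_spec (3 * a + 2).

Lemma mod3P x : mod3_spec x.
Proof.
have : (x %% 3 < 3)%N by rewrite ltn_mod.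
rewrite {2}(divn_eq x 3) mulnC; case: (x %% 3)%N => [|[|[|]]] // _.
- by rewrite addn0; constructor.
- by constructor.
- by constructor.
Qed.

(** Read off from the evaluated entries, one pair of residue classes at a time. *)
Lemma schurM3_skew x y : schurM t3 x y = - schurM t3 y x.
Proof.
case: (mod3P x) => a; case: (mod3P y) => b;
  rewrite ?(schurM3_12, schurM3_21, opprK) ?schurM3_00 ?[LHS]schurM3_0
    ?[in RHS]schurM3_0 ?oppr0 //; try lia.
by rewrite (addrC a%:R b%:R); ring.
Qed.

(** * Schur and Cauchy elimination steps *)

Fixpoint pair_prod (F : nat -> nat -> rat) (s : seq nat) : rat :=
  if s is x :: s' then \prod_(y <- s') F x y * pair_prod F s' else 1.

Lemma prod_nth n (s : seq nat) (G : nat -> rat) : n = size s ->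
  \prod_(i < n) G (nth 0%N s i) = \prod_(x <- s) G x.
Proof. by move=> ->; rewrite (big_nth 0%N) big_mkord. Qed.

Lemma pair_prod_nth n (s : seq nat) F : n = size s ->
  \prod_(i < n) \prod_(j < n | (i < j)%N) F (nth 0%N s i) (nth 0%N s j) =
  pair_prod F s.
Proof.
elim: s n => [|x s IH] n -> /=; first by rewrite big_ord0.
rewrite big_ord_recl; congr (_ * _).
  by rewrite big_mkcond big_ord_recl /= mul1r (prod_nth (F x)).
rewrite -(IH (size s)) //; apply: eq_bigr => i _.
by rewrite big_mkcond big_ord_recl /= mul1r [RHS]big_mkcond.
Qed.

Definition subfrac (x y : nat) : rat := (x%:R - y%:R) / (x%:R + y%:R).

Definition split3 (K M N : seq nat) : seq nat :=
  [seq (3 * i)%N | i <- K] ++ [seq (3 * i + 1)%N | i <- M]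
      ++ [seq (3 * i + 2)%N | i <- N].

Lemma mem_split3_0 z K M N : (3 * z)%N \in split3 K M N -> z \in K.
Proof.
rewrite !mem_cat => /or3P[] /mapP[a ha e]; [|exfalso; lia..].
by have -> : z = a by lia.
Qed.

Lemma prod_split3 K M N (g : nat -> rat) :
  \prod_(i <- split3 K M N) g i = \prod_(a <- K) g (3 * a)%N *
    (\prod_(a <- M) g (3 * a + 1)%N * \prod_(a <- N) g (3 * a + 2)%N).
Proof. by rewrite !big_cat !big_map. Qed.

Definition schur3E := (schurM3_00, schurM3_12, schurM3_21).

Lemma natrD_neq0 a b : (0 < a + b)%N -> a%:R + b%:R != 0 :> rat.
Proof. by rewrite -natrD pnatr_eq0 lt0n. Qed.

Lemma natrD1_neq0 a b : a%:R + b%:R + 1 != 0 :> rat.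
Proof. by rewrite -natrD natr1 pnatr_eq0. Qed.

Lemma schurPf_pair x y K M N : ~~ odd (size (split3 K M N)) ->
    weakly_positive (x :: y :: K) ->
  schurPf t3 (split3 (x :: y :: K) M N) =
  expq x * expq y * subfrac x y *
  \prod_(z <- K) (subfrac x z * subfrac y z) * schurPf t3 (split3 K M N).
Proof.
(* For [x = y] the pivot vanishes and elimination is impossible, but both sides are 0. *)
move=> ev wp; have [xy|xy] := eqVneq x y.
  rewrite -xy (@schurPf_repeat _ _ [::]) /=; last by rewrite negbK.
  by rewrite /subfrac subrr !(mul0r, mulr0).
(* At most one of all these parts is 0, so the denominators do not vanish. *)
have K0 u z : u \in [:: x; y] -> z \in K -> (0 < u + z)%N.
  case: z => [|z]; last by rewrite addnS.
  rewrite !inE; move: wp; rewrite /weakly_positive /= => wp uxy z0.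
  have c0 : (0 < count_mem 0%N K)%N by rewrite -has_count has_pred1.
  case/orP: uxy => /eqP->; rewrite addn0 lt0n; apply/eqP => e0;
    rewrite e0 eqxx in wp; move: wp c0; case: (count_mem 0%N K) => // c;
    by rewrite !addnS; case: (_ == _).
(* The pivots [3x] and [3y] pair to 0 with the other residue classes, whose entries are therefore
   unchanged. *)
pose g i := if (3 %| i)%N then subfrac x (i %/ 3) * subfrac y (i %/ 3) else 1.
have g0 a : g (3 * a)%N = subfrac x a * subfrac y a.
  by rewrite /g dvdn_mulr // mulKn.
have g1 a : g (3 * a + 1)%N = 1 by rewrite /g ifF //; lia.
have g2 a : g (3 * a + 2)%N = 1 by rewrite /g ifF //; lia.
have xy0 : x%:R + y%:R != 0 :> rat by apply: natrD_neq0; move/eqP: xy; lia.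
rewrite -[split3 (x :: _) _ _]/(3 * x :: 3 * y :: split3 K M N)%N.
rewrite (@schurPf_eliminate _ _ schurM3_skew _ _ (split3 K M N) g) //;
  first last.
{ move=> i j; case: (mod3P i) => a; case: (mod3P j) => b ha hb;
    rewrite ?g0 ?g1 ?g2 ?schur3E.
  + have {}ha := mem_split3_0 ha; have {}hb := mem_split3_0 hb.
    have xa := natrD_neq0 (K0 x a (mem_head _ _) ha).
    have xb := natrD_neq0 (K0 x b (mem_head _ _) hb).
    have y_in : y \in [:: x; y] by rewrite !inE eqxx orbT.
    have ya := natrD_neq0 (K0 y a y_in ha).
    have yb := natrD_neq0 (K0 y b y_in hb).
    (* Here [a + b] may be 0, so [field] would not apply. *)
    have [->|ab] := eqVneq a b; first by rewrite subrr mul0r; ring.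
    have ab0 : a%:R + b%:R != 0 :> rat by apply: natrD_neq0; move/eqP: ab; lia.
    by rewrite /subfrac; field; rewrite xa xb ya yb ab0 xy0.
  all: rewrite ?(@schurM3_0 (3 * a)) ?(@schurM3_0 (3 * a + 1))
     ?(@schurM3_0 (3 * a + 2)) ?(@schurM3_0 (3 * x))
     ?(@schurM3_0 (3 * y)); try lia.
  all: by rewrite ?(mulr0, mul0r, mul1r) ?addr0 ?subr0. }
{ rewrite schurM3_00; apply: mulf_neq0.
    exact: mulf_neq0 (expq_neq0 x) (expq_neq0 y).
  by rewrite mulf_neq0 ?invr_neq0 // subr_eq0 eqr_nat. }
rewrite schurM3_00 prod_split3; congr (_ * _ * _).
under eq_bigr => a _ do rewrite g0.
under [X in _ * (X * _)]eq_bigr => a _ do rewrite g1.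
under [X in _ * (_ * X)]eq_bigr => a _ do rewrite g2.
by rewrite !big1_eq !mulr1.
Qed.

(** The 4 by 4 Pfaffian on the parts of [m, n, a, b] is, up to scalars, a 2 by 2 Cauchy determinant,
    with numerator [(a - m) * (b - n)]. The sign comes from moving [3n + 2] past the parts of [M] to
    stand next to [3m + 1]. *)
Lemma schurPf_cauchy m n M N : ~~ odd (size M + size N) ->
  schurPf t3 (split3 [::] (m :: M) (n :: N)) =
  (-1) ^+ size M * (expq m * expq n * (4%:R / 3%:R / (m%:R + n%:R + 1)) *
  (\prod_(a <- M) ((a%:R - m%:R) / (a%:R + n%:R + 1)) *
   \prod_(b <- N) ((b%:R - n%:R) / (m%:R + b%:R + 1)))
  * schurPf t3 (split3 [::] M N)).
Proof.
move=> ev; rewrite /split3 /=.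
rewrite (@schurPf_move _ t3 [:: (3 * m + 1)%N]) /=; last first.
  by rewrite !size_cat /= !size_map addnS negbK.
rewrite size_map; congr (_ * _).
pose g i : rat := if (i %% 3 == 1)%N
  then ((i %/ 3)%:R - m%:R) / ((i %/ 3)%:R + n%:R + 1)
  else ((i %/ 3)%:R - n%:R) / (m%:R + (i %/ 3)%:R + 1).
have g1 a : g (3 * a + 1)%N = (a%:R - m%:R) / (a%:R + n%:R + 1).
  by rewrite /g ifT; [congr ((_%:R - _) / (_%:R + _ + 1)) | ]; lia.
have g2 a : g (3 * a + 2)%N = (a%:R - n%:R) / (m%:R + a%:R + 1).
  by rewrite /g ifF; [congr ((_%:R - _) / (_ + _%:R + 1)) | ]; lia.
have n0 a : ((3 * a)%N \in split3 [::] M N) = false.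
  by apply/negP => /mem_split3_0.
have c0 : 4%:R / 3%:R != 0 :> rat by [].
rewrite (@schurPf_eliminate _ _ schurM3_skew _ _ (split3 [::] M N) g);
  first last.
{ move=> i j; case: (mod3P i) => a; case: (mod3P j) => b;
    rewrite ?n0 // => _ _; rewrite ?g1 ?g2 ?schur3E ?(@schurM3_0 (3 * a + 1))
     ?(@schurM3_0 (3 * a + 2)) ?(@schurM3_0 (3 * m + 1))
     ?(@schurM3_0 (3 * n + 2)); try lia.
  all: rewrite ?(mulr0, mul0r) ?(addr0, subr0, oppr0) //.
  all: by field; rewrite !natrD1_neq0. }
{ rewrite schurM3_12; apply: mulf_neq0.
    exact: mulf_neq0 (expq_neq0 m) (expq_neq0 n).
  by rewrite mulf_neq0 ?invr_neq0 ?natrD1_neq0. }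
{ by rewrite !size_cat !size_map. }
rewrite schurM3_12 prod_split3 big_nil mul1r.
by congr (_ * (_ * _) * _); apply: eq_bigr => a _; rewrite ?g1 ?g2.
Qed.

(** For equal sizes, the Pfaffian of the block matrix with zero diagonal blocks and off-diagonal
    blocks [C] and [- C^T], where [C] has entries [(4/3) / (x + y + 1)]: a sign times a Cauchy
    determinant. *)
Definition cauchyq (M N : seq nat) : rat :=
  (size M == size N)%:R * (-1) ^+ (size N * (size N - 1) %/ 2)%N *
  (4%:R / 3%:R) ^+ size N *
  (pair_prod (fun x y => x%:R - y%:R) M * pair_prod (fun x y => x%:R - y%:R) N
   / (\prod_(x <- M) \prod_(y <- N) (x%:R + y%:R + 1))).

Lemma cauchyq_cons m n M N : size M = size N ->
  cauchyq (m :: M) (n :: N) =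
  (-1) ^+ size M * (4%:R / 3%:R / (m%:R + n%:R + 1) *
  (\prod_(a <- M) ((a%:R - m%:R) / (a%:R + n%:R + 1)) *
   \prod_(b <- N) ((b%:R - n%:R) / (m%:R + b%:R + 1))) * cauchyq M N).
Proof.
move=> MN; rewrite /cauchyq /= eqSS MN eqxx !mul1r.
have opp_prod x s : \prod_(a <- s) (a%:R - x%:R) =
    (-1) ^+ size s * \prod_(a <- s) (x%:R - a%:R) :> rat.
  elim: s => [|a s IH]; rewrite ?big_nil ?mulr1 // !big_cons IH exprS.
  by ring.
rewrite !prodf_div !opp_prod MN !big_cons.
under [X in _ / (_ * X)]eq_bigr => a _ do rewrite big_cons.
rewrite big_split /=.
have -> : ((size N).+1 * ((size N).+1 - 1) %/ 2 =
    size N + size N * (size N - 1) %/ 2)%N.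
  rewrite -divnMDl //; congr (_ %/ _)%N; case: (size N) => //= l; nia.
rewrite exprD exprS; set e := (-1) ^+ size N.
have e2 : e * e = 1 by rewrite -expr2 sqrr_sign.
rewrite !invfM.
(* One [e] is the sign in front, the other two come from reversing the differences in both products;
   what remains is the extra sign in the exponent. *)
transitivity (e * e * e * (-1) ^+ (size N * (size N - 1) %/ 2) *
  (4%:R / 3%:R * (4%:R / 3%:R) ^+ size N) *
 (\prod_(y <- M) (m%:R - y%:R) *
  pair_prod (fun x y : nat => x%:R - y%:R) M *
  (\prod_(y <- N) (n%:R - y%:R) *
   pair_prod (fun x y : nat => x%:R - y%:R) N)) *
  ((m%:R + n%:R + 1)^-1 / (\prod_(j <- N) (m%:R + j%:R + 1)) *
   ((\prod_(i <- M) (i%:R + n%:R + 1))^-1 /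
    (\prod_(i <- M) \prod_(j <- N) (i%:R + j%:R + 1))))).
  by rewrite e2 mul1r !mulrA.
by ring.
Qed.

(** * Evaluation of the Q-polynomials *)

Lemma size_split3 K M N : size (split3 K M N) = (size K + (size M + size N))%N.
Proof. by rewrite !size_cat !size_map. Qed.

Lemma cauchyq_neq M N : size M <> size N -> cauchyq M N = 0.
Proof. by rewrite /cauchyq; case: eqP => // _ _; rewrite !mul0r. Qed.

(** All remaining parts lie in one nonzero residue class, so no two indices add up to a multiple of
    3 and the first row is zero. *)
Lemma schurPf_null_MN M N : ~~ odd (size M + size N) ->
    (size M == 0%N) || (size N == 0%N) -> size M <> size N ->
  schurPf t3 (split3 [::] M N) = 0.
Proof.
move=> ev; rewrite !size_eq0 => /orP[] /eqP e; rewrite e in ev *.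
  case: N ev {e} => [|n N] ev // _.
  apply: (@schurPf_null_row _ _ schurM3_skew [::]).
    by rewrite /= size_map.
  by move=> y /=; rewrite inE => /orP[/eqP->|/mapP[b _ ->]];
    rewrite schurM3_0 //; lia.
case: M ev {e} => [|m M] ev // _.
apply: (@schurPf_null_row _ _ schurM3_skew [::]).
  by move: ev; rewrite /= size_cat size_map.
by move=> y; rewrite inE mem_cat => /or3P[/eqP->|/mapP[b _ ->]|] //;
  rewrite schurM3_0 //; lia.
Qed.

Lemma schurPf_MN M N : ~~ odd (size M + size N) ->
  schurPf t3 (split3 [::] M N) =
  \prod_(a <- M) expq a * \prod_(b <- N) expq b * cauchyq M N.
Proof.
elim: M N => [|m M IH] [|n N] ev.
- rewrite !big_nil /cauchyq !big_nil /= expr0 divr1 !mulr1.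
  exact: (schurQ_nil t3).
- by rewrite schurPf_null_MN // cauchyq_neq // mulr0.
- by rewrite schurPf_null_MN // cauchyq_neq // mulr0.
have {}ev : ~~ odd (size M + size N) by move: ev; rewrite /= addnS negbK.
rewrite schurPf_cauchy // IH // !big_cons.
have [MN|/eqP MN] := eqVneq (size M) (size N).
  by rewrite cauchyq_cons //; ring.
by rewrite !cauchyq_neq ?mulr0 //= => -[].
Qed.

Lemma schurPf_split3 K M N :
    weakly_positive K -> ~~ odd (size (split3 K M N)) ->
  schurPf t3 (split3 K M N) = \prod_(a <- K) expq a * pair_prod subfrac K *
    (\prod_(a <- M) expq a * \prod_(b <- N) expq b * cauchyq M N).
Proof.
have [n] := ubnP (size K); elim: n K => // n IH [|x [|y K]] Kn wp ev.
- by rewrite schurPf_MN ?big_nil ?mul1r //; rewrite size_split3 in ev.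
(* With a single multiple of 3 left, parity forces [size M] and [size N] to differ, and the row of
   [3x] is zero. *)
- rewrite cauchyq_neq ?mulr0 => [|MN]; last first.
    by move: ev; rewrite size_split3 /= MN addnn odd_double.
  apply: (@schurPf_null_row _ _ schurM3_skew [::]) => // y.
  rewrite /= inE => /orP[/eqP->|].
    by rewrite schurM3_00 subrr mul0r mulr0.
  by rewrite mem_cat => /orP[] /mapP[b _ ->]; rewrite schurM3_0 //; lia.
have {}ev : ~~ odd (size (split3 K M N)) by move: ev; rewrite /= negbK.
rewrite schurPf_pair // IH //; first last.
- by apply: leq_trans wp; rewrite /= addnA leq_addl.
- by move: Kn => /=; lia.
rewrite /= !big_cons big_split /=; ring.
Qed.

(** * Zero parts and partitions of odd length *)

Lemma subfrac_0r x : (0 < x)%N -> subfrac x 0 = 1.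
Proof.
by move=> x0; rewrite /subfrac mulr0n subr0 divff // pnatr_eq0 -lt0n.
Qed.

Lemma subfrac_0l y : (0 < y)%N -> subfrac 0 y = -1.
Proof.
move=> y0; rewrite /subfrac mulr0n sub0r add0r mulNr divff //.
by rewrite pnatr_eq0 -lt0n.
Qed.

Lemma prod_subfrac_pos x s : (0 < x)%N ->
  \prod_(y <- s) subfrac x y = \prod_(y <- filter (leq 1) s) subfrac x y.
Proof.
move=> x0; rewrite big_filter [RHS]big_mkcond; apply: eq_bigr => -[|y] _ //=.
by rewrite subfrac_0r.
Qed.

Lemma prod_subfrac_0 s : 0%N \notin s ->
  \prod_(y <- s) subfrac 0 y = (-1) ^+ count (leq 1) s.
Proof.
elim: s => [|y s IH]; rewrite ?big_nil // inE => /norP[].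
rewrite eq_sym -lt0n => y0 s0; rewrite big_cons subfrac_0l // IH //.
by rewrite /= y0 exprS.
Qed.

(** A part 0 contributes 1 against each earlier part and -1 against each later one, so this product
    follows the same sign rule as [schurQ]. *)
Lemma pair_prod_pos K : weakly_positive K ->
  pair_prod subfrac K =
  (-1) ^+ zero_inv K * pair_prod subfrac (filter (leq 1) K).
Proof.
elim: K => [|x K IH] /=; first by rewrite mulr1.
rewrite /weakly_positive /= => wp; rewrite IH; last first.
  by rewrite /weakly_positive (leq_trans _ wp) // leq_addl.
case: x wp => [|x] wp /=; last by rewrite prod_subfrac_pos // add0n; ring.
rewrite prod_subfrac_0 ?exprD ?mulrA //; apply/count_memPn.
by move: wp; rewrite add1n ltnS leqn0 => /eqP.
Qed.

(** The parts from [M] and [N] are positive, so each zero of [K] has to pass all of them as well. *)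
Lemma zero_inv_split3 K M N :
  zero_inv (split3 K M N) =
  (zero_inv K + count_mem 0%N K * (size M + size N))%N.
Proof.
pose MN := [seq (3 * i + 1)%N | i <- M] ++ [seq (3 * i + 2)%N | i <- N].
have pos : 0%N \notin MN.
  by rewrite mem_cat; apply/norP; split; apply/negP => /mapP[a _]; lia.
elim: K => [|x K IH].
  by rewrite /= zero_inv_pos.
rewrite /= IH /= muln_eq0 /= count_cat count_map.
rewrite -/MN; have -> : count (leq 1) MN = (size M + size N)%N.
  rewrite (eq_in_count (a2 := predT)) ?count_predT ?size_cat ?size_map //.
  by move=> [|y] // y0; rewrite y0 in pos.
rewrite (@eq_count _ _ (leq 1)) => [|y]; last by rewrite /= muln_gt0.
by case: (x == 0%N); rewrite ?add0n //=; lia.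
Qed.

Lemma filter_split3 K M N :
  filter (leq 1) (split3 K M N) = split3 (filter (leq 1) K) M N.
Proof.
rewrite /split3 !filter_cat !filter_map; congr (_ ++ (_ ++ _)).
- by congr map; apply: eq_filter => y /=; rewrite muln_gt0.
- by congr map; apply/all_filterP/allP => y _ /=; rewrite addn1.
- by congr map; apply/all_filterP/allP => y _ /=; rewrite addn2.
Qed.

Lemma pair_prod_rcons0 K : 0%N \notin K ->
  pair_prod subfrac (rcons K 0%N) = pair_prod subfrac K.
Proof.
elim: K => [|x K IH]; first by rewrite /= big_nil mulr1.
rewrite inE => /norP[x0 K0] /=; rewrite IH // -cats1 big_cat big_seq1.
by rewrite /= subfrac_0r ?mulr1 // lt0n eq_sym.
Qed.

Lemma expq0 : expq 0 = 1.
Proof. by []. Qed.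

Lemma prod_expq_pos K :
  \prod_(a <- filter (leq 1) K) expq a = \prod_(a <- K) expq a.
Proof.
by rewrite big_filter big_mkcond; apply: eq_bigr => -[].
Qed.

Lemma schurQ_split3 K M N : weakly_positive K ->
  schurQ t3 (split3 K M N) = \prod_(a <- K) expq a * pair_prod subfrac K *
    (\prod_(a <- M) expq a * \prod_(b <- N) expq b * cauchyq M N).
Proof.
move=> wp; rewrite schurQE filter_split3 zero_inv_split3 pair_prod_pos //.
rewrite -(prod_expq_pos K); set K' := filter _ K.
have K0 : 0%N \notin K' by rewrite mem_filter.
have E L : 0%N \notin L -> ~~ odd (size (split3 L M N)) ->
    schurPf t3 (split3 L M N) = \prod_(a <- L) expq a * pair_prod subfrac L *
      (\prod_(a <- M) expq a * \prod_(b <- N) expq b * cauchyq M N).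
  move=> L0; apply: schurPf_split3.
  by rewrite /weakly_positive (count_memPn L0).
set B := schurPf _ (rcons _ _).
have EB : odd (size (split3 K' M N)) ->
    B = (-1) ^+ (size M + size N) *
     (\prod_(a <- K') expq a * pair_prod subfrac K' *
      (\prod_(a <- M) expq a * \prod_(b <- N) expq b * cauchyq M N)).
  (* The appended 0 is moved in front of the parts from [M] and [N], where it counts as a further
     multiple of 3. *)
  move=> od; rewrite /B -cats1 -catA schurPf_move; last by
    rewrite catA size_cat addn1 /= od.
  rewrite size_cat !size_map cats0; congr (_ * _).
  have E0 : rcons [seq (3 * i)%N | i <- K'] 0%N =
      [seq (3 * i)%N | i <- rcons K' 0%N] by rewrite map_rcons.
  rewrite -cat_rcons E0.
  rewrite -/(split3 (rcons K' 0%N) M N).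
  rewrite schurPf_split3; first last.
  - by move: od; rewrite !size_split3 size_rcons /= => ->.
  - by rewrite /weakly_positive -cats1 count_cat (count_memPn K0).
  by rewrite pair_prod_rcons0 // -cats1 big_cat big_seq1 /= expq0 mulr1.
(* The additional signs are powers of [(-1) ^+ (size M + size N)]: they are 1 for equal sizes, and
   otherwise both sides are 0. *)
have [MN|/eqP MN] := eqVneq (size M) (size N); last first.
  by case: ifP => [/EB->|/negbT ev]; rewrite ?E // cauchyq_neq ?mulr0.
have sgn k : (-1) ^+ (k * (size M + size N)) = 1 :> rat.
  by rewrite MN addnn -signr_odd oddM odd_double andbF.
rewrite exprD sgn mulr1.
suff -> : (if odd (size (split3 K' M N)) then B
           else schurPf t3 (split3 K' M N)) =
    \prod_(a <- K') expq a * pair_prod subfrac K' *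
      (\prod_(a <- M) expq a * \prod_(b <- N) expq b * cauchyq M N) by ring.
case: ifP => [/EB->|/negbT ev]; last exact: E.
by rewrite -[(size M + _)%N]mul1n sgn mul1r.
Qed.

(** * The closed formula *)

Lemma prod_expq s :
  \prod_(a <- s) expq a = (2%:R / 3%:R) ^+ sumn s / \prod_(a <- s) (a`!)%:R.
Proof.
elim: s => [|a s IH]; first by rewrite !big_nil /= divr1.
by rewrite !big_cons IH /= exprD invfM /expq; ring.
Qed.

Lemma sumn_split3 K M N :
  sumn (split3 K M N) =
  (3 * (sumn K + sumn M + sumn N) + size M + 2 * size N)%N.
Proof.
have S d s : sumn [seq (3 * i + d)%N | i <- s] = (3 * sumn s + d * size s)%N.
  by elim: s => [|x s IH] /=; rewrite ?muln0 // IH; lia.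
rewrite /split3 !sumn_cat !S.
have -> : [seq (3 * i)%N | i <- K] = [seq (3 * i + 0)%N | i <- K].
  by apply: eq_map => i; rewrite addn0.
by rewrite S; lia.
Qed.

Theorem theorem3p1 (p q r : nat)
    (k : p.-tuple nat) (m : q.-tuple nat) (n : r.-tuple nat) :
  let lambda : seq nat :=
    [seq (3 * i)%N | i <- k] ++ [seq (3 * i + 1)%N | i <- m]
      ++ [seq (3 * i + 2)%N | i <- n] in
  weakly_positive lambda ->
  let A : rat := schurQ (fun j : nat => (j == 3%N)%:R / 3%:R) lambda in
  let k_ (i : nat) : nat := nth 0%N k i in
  let m_ (i : nat) : nat := nth 0%N m i in
  let n_ (i : nat) : nat := nth 0%N n i in
  (* if q = r then |lambda| is divisible by 3 *)
  A = (q == r)%:R * (-1) ^+ (r * (r - 1) %/ 2)%N * 2%:R ^+ r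
        * (2%:R / 3%:R) ^+ (sumn lambda %/ 3)%N
      / ((\prod_(i < p) ((k_ i)`!)%:R) * (\prod_(i < q) ((m_ i)`!)%:R)
           * (\prod_(i < r) ((n_ i)`!)%:R))
      * (\prod_(i < p) \prod_(j < p | (i < j)%N)
           (((k_ i)%:R - (k_ j)%:R) / ((k_ i)%:R + (k_ j)%:R)))
      * ((\prod_(i < r) \prod_(j < r | (i < j)%N)
            (((m_ i)%:R - (m_ j)%:R) * ((n_ i)%:R - (n_ j)%:R)))
         / (\prod_(i < r) \prod_(j < r) ((m_ i)%:R + (n_ j)%:R + 1)))
  /\ (q <> r -> A = 0).
Proof.
move=> lambda wp A k_ m_ n_.
have sk := esym (size_tuple k); have sm := esym (size_tuple m).
have sn := esym (size_tuple n).
have wpk : weakly_positive k.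
  apply: leq_trans wp; rewrite count_cat count_map.
  rewrite (@eq_count _ _ (pred1 0%N)) ?leq_addr // => i /=.
  by rewrite muln_eq0.
have AE : A = _ := schurQ_split3 m n wpk.
have [qr|/eqP qr] := eqVneq q r; last first.
  have A0 : A = 0 by rewrite AE cauchyq_neq -?sm -?sn // !mulr0.
  by rewrite A0 !mul0r.
subst q; split=> // {wp wpk}; rewrite {}AE !prod_expq.
(* The residues 1 and 2 add up to [3 * r], as both classes have [r] parts. *)
have -> : (sumn lambda %/ 3 = sumn k + sumn m + sumn n + r)%N.
  by rewrite [sumn lambda]sumn_split3 -sm -sn; lia.
rewrite /cauchyq -sm -sn eqxx.
have -> : \prod_(i < p) \prod_(j < p | (i < j)%N)
  (((k_ i)%:R - (k_ j)%:R) / ((k_ i)%:R + (k_ j)%:R)) = pair_prod subfrac k.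
  exact: (pair_prod_nth subfrac sk).
have -> : \prod_(i < r) \prod_(j < r | (i < j)%N)
    (((m_ i)%:R - (m_ j)%:R) * ((n_ i)%:R - (n_ j)%:R)) =
    pair_prod (fun x y => x%:R - y%:R) m *
    pair_prod (fun x y => x%:R - y%:R) n :> rat.
  rewrite -(pair_prod_nth _ sm) -(pair_prod_nth _ sn) -big_split.
  by apply: eq_bigr => i _; rewrite -big_split.
have -> : \prod_(i < r) \prod_(j < r) ((m_ i)%:R + (n_ j)%:R + 1) =
    \prod_(x <- m) \prod_(y <- n) (x%:R + y%:R + 1) :> rat.
  rewrite -(prod_nth _ sm); apply: eq_bigr => i _.
  by rewrite -(prod_nth _ sn).
rewrite (prod_nth (fun a => (a`!)%:R) sk) (prod_nth (fun a => (a`!)%:R) sm).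
rewrite (prod_nth (fun a => (a`!)%:R) sn).
(* The Cauchy constant supplies [2 ^ r] and the [r] powers of 2/3 not provided by the [expq]
   factors. *)
have -> : 4%:R / 3%:R = 2%:R * (2%:R / 3%:R) :> rat by [].
by rewrite [(2%:R * (_ / _)) ^+ r]exprMn !exprD !invfM; ring.
Qed.
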